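(* Let $E$ be a real Banach lattice. Then $\mathrm{r\text{-}L}_{Leb}(E)$ and $\mathrm{r\text{-}L}^{\sigma}_{Leb}(E)$ are both left algebraic ideals of $\mathrm{L}_r(E)$, and hence subalgebras of $\mathrm{L}_r(E)$. Furthermore: (i) $\mathrm{r\text{-}L}_{Leb}(E)$ (resp., $\mathrm{r\text{-}L}^{\sigma}_{Leb}(E)$) coincides with $\mathrm{L}_r(E)$ if and only if the norm of $E$ is order continuous (resp., $\sigma$-order continuous). (ii) If $E$ is Dedekind complete, then $\|T\|_{\mathrm{r\text{-}P}}=\|T\|_r$ for each $T\in \mathrm{r\text{-}L}_{Leb}(E)$, where $\mathrm{P}=\mathrm{L}_{Leb}(E)$; and $(\mathrm{r\text{-}L}_{Leb}(E),\|\cdot\|_{\mathrm{r\text{-}P}})$ with $\mathrm{P}=\mathrm{L}_{Leb}(E)$ (resp., $(\mathrm{r\text{-}L}^{\sigma}_{Leb}(E),\|\cdot\|_{\mathrm{r\text{-}P}})$ with $\mathrm{P}=\mathrm{L}^{\sigma}_{Leb}(E)$) is a Banach lattice algebra.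
   Context: $\mathrm{L}(E)$ is the algebra of all continuous linear operators $E\to E$, ordered by $S\le T$ iff $(T-S)x\ge 0$ for all $x\in E_+$. $\mathrm{L}_r(E)$ is the ordered subalgebra of regular operators (differences of two positive operators), with the regular norm $\|T\|_r=\inf\{\|S\|:\pm T\le S\in \mathrm{L}_r(E)\}$. An operator $T\in \mathrm{L}(E)$ is Lebesgue (resp., $\sigma$-Lebesgue) if $\|Tx_\alpha\|\to 0$ for every net (resp., sequence) $(x_\alpha)_\alpha$ in $E$ with $x_\alpha\downarrow 0$ (decreasing with infimum $0$). The set of all such operators is denoted $\mathrm{L}_{Leb}(E)$ (resp., $\mathrm{L}^{\sigma}_{Leb}(E)$). For a set $\mathrm{P}$ of operators in $E$, an operator $T:E\to E$ is a regularly $\mathrm{P}$-operator (r-P-operator) if $T=T_1-T_2$ for some positive $T_1,T_2\in\mathrm{P}$. The set of all r-P-operators is denoted $\mathrm{r\text{-}P}(E)$; for $\mathrm{P}=\mathrm{L}_{Leb}(E)$ and $\mathrm{P}=\mathrm{L}^{\sigma}_{Leb}(E)$ it is written $\mathrm{r\text{-}L}_{Leb}(E)$ and $\mathrm{r\text{-}L}^{\sigma}_{Leb}(E)$. For $T\in \mathrm{r\text{-}P}(E)$, $\|T\|_{\mathrm{r\text{-}P}}=\inf\{\|S\|:\pm T\le S\in \mathrm{P}\}$. A left algebraic ideal of $\mathrm{L}_r(E)$ is a vector subspace $J$ with $ST\in J$ for all $S\in \mathrm{L}_r(E)$, $T\in J$. The norm of $E$ is order continuous (resp., $\sigma$-order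 continuous) if $\|x_\alpha\|\to0$ for every net (resp., sequence) $x_\alpha\downarrow 0$ in $E$. A Banach lattice algebra is a Banach lattice that is an algebra in which products of positive elements are positive and the norm is submultiplicative; here the order is the one induced from $\mathrm{L}_r(E)$ and the product is composition. *)

(* Defs.v *)
From mathcomp Require Import all_boot all_order all_algebra.
From mathcomp Require Import all_classical all_reals all_analysis.

Set Implicit Arguments.
Unset Strict Implicit.
Unset Printing Implicit Defensive.

Import Order.TTheory GRing.Theory Num.Theory.
Import numFieldNormedType.Exports.

Local Open Scope classical_set_scope.
Local Open Scope ring_scope.

(* The orders below are relations and not instances of [porderType]: the
   hierarchy has no join of ordered types and normed modules to extend, and an
   operator space needs an order other than the pointwise one. A structure is
   carried by a subset [J] of an ambient type; its order, norm and product are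
   only constrained on [J], and suprema and infima are taken inside [J]. *)

Section Bounds.
Variables (V : Type) (J : set V) (le : V -> V -> Prop).

Definition is_sup (A : set V) (s : V) : Prop :=
  [/\ J s, forall x, A x -> le x s
    & forall u, J u -> (forall x, A x -> le x u) -> le s u].

Definition is_inf (A : set V) (s : V) : Prop :=
  [/\ J s, forall x, A x -> le s x
    & forall u, J u -> (forall x, A x -> le u x) -> le u s].

Definition dedekind_complete : Prop :=
  forall A : set V, A `<=` J -> A !=set0 ->
    (exists2 u, J u & forall x, A x -> le x u) -> exists s, is_sup A s.

End Bounds.

Section BanachLattice.
Variables (R : realType) (V : lmodType R) (J : set V).
Variables (le : V -> V -> Prop) (N : V -> R).

Record banach_lattice : Prop := {
  bl_subspace : GRing.submod_closed (mem J) ;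
  bl_refl : forall x, J x -> le x x ;
  bl_anti : forall x y, J x -> J y -> le x y -> le y x -> x = y ;
  bl_trans : forall x y z, J x -> J y -> J z -> le x y -> le y z -> le x z ;
  bl_leD : forall x y z, J x -> J y -> J z -> le x y -> le (x + z) (y + z) ;
  bl_leZ : forall (a : R) x y, J x -> J y -> 0 <= a -> le x y ->
    le (a *: x) (a *: y) ;
  bl_sup : forall x y, J x -> J y -> exists s, is_sup J le [set x; y] s ;
  bl_inf : forall x y, J x -> J y -> exists s, is_inf J le [set x; y] s ;
  bl_norm_ge0 : forall x, J x -> 0 <= N x ;
  bl_norm_eq0 : forall x, J x -> N x = 0 -> x = 0 ;
  bl_normZ : forall (a : R) x, J x -> N (a *: x) = `|a| * N x ;
  bl_normD : forall x y, J x -> J y -> N (x + y) <= N x + N y ;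
  (* |x| <= |y| -> N x <= N y, where u = |x| and v = |y| *)
  bl_le_norm : forall x y u v, J x -> J y ->
    is_sup J le [set x; - x] u -> is_sup J le [set y; - y] v ->
    le u v -> N x <= N y ;
  bl_complete : forall w : nat -> V, (forall n, J (w n)) ->
    (forall e : R, 0 < e -> exists n0 : nat, forall m n : nat,
      (n0 <= m)%N -> (n0 <= n)%N -> N (w m - w n) < e) ->
    exists2 l, J l & N (w n - l) @[n --> \oo] --> (0 : R) }.

(* No unit is required. *)
Record banach_lattice_algebra (mul : V -> V -> V) : Prop := {
  bla_lattice : banach_lattice ;
  bla_mul : forall x y, J x -> J y -> J (mul x y) ;
  bla_mulA : forall x y z, J x -> J y -> J z ->
    mul x (mul y z) = mul (mul x y) z ;
  bla_mulDl : forall x y z, J x -> J y -> J z ->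
    mul (x + y) z = mul x z + mul y z ;
  bla_mulDr : forall x y z, J x -> J y -> J z ->
    mul x (y + z) = mul x y + mul x z ;
  bla_mulZl : forall (a : R) x y, J x -> J y ->
    mul (a *: x) y = a *: mul x y ;
  bla_mulZr : forall (a : R) x y, J x -> J y ->
    mul x (a *: y) = a *: mul x y ;
  bla_mul_ge0 : forall x y, J x -> J y -> le 0 x -> le 0 y -> le 0 (mul x y) ;
  bla_normM : forall x y, J x -> J y -> N (mul x y) <= N x * N y }.

End BanachLattice.

Record directed (I : Type) (r : I -> I -> Prop) : Prop := {
  directed_inh : inhabited I ;
  directed_refl : forall i, r i i ;
  directed_trans : forall i j k, r i j -> r j k -> r i k ;
  directed_ub : forall i j, exists k, r i k /\ r j k }.

Definition net_tails (I : Type) (r : I -> I -> Prop) : set_system I :=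
  filter_from setT (fun i => [set j | r i j]).

Section Operators.
Variables (R : realType) (E : normedModType R) (le : E -> E -> Prop).
Implicit Types (S T : E -> E) (P J : set (E -> E)).

Definition net_decr0 (I : Type) (r : I -> I -> Prop) (x : I -> E) : Prop :=
  (forall i j, r i j -> le (x j) (x i)) /\ is_inf setT le (range x) 0.

Definition seq_decr0 (x : nat -> E) : Prop :=
  (forall m n : nat, (m <= n)%N -> le (x n) (x m)) /\
  is_inf setT le (range x) 0.

Definition order_continuous_norm : Prop :=
  forall (I : Type) (r : I -> I -> Prop) (x : I -> E),
    directed r -> net_decr0 r x ->
    (fun i => `|x i|) @ net_tails r --> (0 : R).

Definition sigma_order_continuous_norm : Prop :=
  forall x : nat -> E, seq_decr0 x -> `|x n| @[n --> \oo] --> (0 : R).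

Definition L_op : set (E -> E) := [set T | linear T /\ continuous T].

Definition op_le S T : Prop := forall x : E, le 0 x -> le 0 ((T - S) x).

Definition op_norm T : R := sup [set `|T x| | x in [set x : E | `|x| <= 1]].

Definition r_op P : set (E -> E) :=
  [set T | exists T1 T2, [/\ P T1, P T2, op_le 0 T1, op_le 0 T2
                           & T = T1 - T2]].

(* The regular norm is [r_norm L_r]. *)
Definition r_norm P T : R :=
  inf [set op_norm S | S in [set S | [/\ P S, op_le T S & op_le (- T) S]]].

Definition L_r : set (E -> E) := r_op L_op.

Definition L_Leb : set (E -> E) :=
  [set T | L_op T /\
    forall (I : Type) (r : I -> I -> Prop) (x : I -> E),
      directed r -> net_decr0 r x ->
      (fun i => `|T (x i)|) @ net_tails r --> (0 : R)].

Definition L_sLeb : set (E -> E) :=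
  [set T | L_op T /\
    forall x : nat -> E, seq_decr0 x -> `|T (x n)| @[n --> \oo] --> (0 : R)].

Definition left_algebraic_ideal J : Prop :=
  [/\ J `<=` L_r, GRing.submod_closed (mem J)
    & forall S T, L_r S -> J T -> J (S \o T)].

Definition subalgebra J : Prop :=
  [/\ J `<=` L_r, GRing.submod_closed (mem J)
    & forall S T, J S -> J T -> J (S \o T)].

End Operators.

(* Main.v *)
Require Import Defs.
From HB Require Import structures.
From mathcomp Require Import all_boot all_order all_algebra.
From mathcomp Require Import all_classical all_reals all_analysis.
From mathcomp Require Import lra.

Set Implicit Arguments.
Unset Strict Implicit.
Unset Printing Implicit Defensive.

Import Order.TTheory GRing.Theory Num.Theory.
Import numFieldNormedType.Exports.

Local Open Scope classical_set_scope.
Local Open Scope ring_scope.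

(** The argument rests on the relation [dominated T S], which expresses
    [|T| <= S] on the positive cone even when [|T|] is not known to exist. Three
    facts make it effective. In norm, [T] is controlled by [S], because every
    [x] lies between [- w] and [w] for some [w] of the same norm
    ([abs_exists], [dominated_norm]). It is compatible with sums, scalars and
    composition. Finally an operator is a difference of positive members of [P]
    exactly when it is linear and dominated by a member of [P] ([r_opP]), where
    [P] is any class of bounded operators that is closed under linear
    combinations, composition on the left with bounded operators, domination
    and operator-norm limits (an [operator_ideal]). The bounded, the Lebesgue
    and the sigma-Lebesgue operators are such classes for one and the same
    reason: each is defined by convergence to [0] along certain eventually
    bounded families of positive vectors ([vanishing_ideal]). So every statement
    is proved once, for a general [P].

    - Left ideal: if [A] dominates [S] and [B] dominates [T], then [A \o B]
      dominates [S \o T] ([r_op_comp]); the same fact makes the norm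
      submultiplicative ([r_normM]).
    - Part (i): the differences of positive members of [P] exhaust the regular
      operators if and only if the identity belongs to [P] ([r_op_eq_L_r]), and
      the identity is a Lebesgue operator precisely when the norm is order
      continuous.
    - Lattice structure: in a Dedekind complete lattice the Riesz-Kantorovich
      formula provides [T^+] as a linear map below every positive linear map
      above [T] ([riesz_kantorovich]). A member of [P] that dominates [T]
      dominates [T^+] as well, so suprema stay in the class ([r_op_join]).
      Likewise [|T|] is in [P] and has the smallest operator norm among the
      bounded operators that dominate [T]; hence the norm relative to [P] is
      the regular norm ([r_norm_L_op]).
    - Completeness: a rapidly Cauchy sequence has increments dominated by
      members of [P] with summable norms; the remainders of the pointwise limit
      are dominated by the remainders of a convergent series in [P]
      ([r_norm_complete]). *)

(** * The order of the lattice through its positive cone *)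

Section Cone.
Variables (R : realType) (E : normedModType R) (le : E -> E -> Prop).
Hypothesis hE : banach_lattice setT le (fun x : E => `|x|).
Local Notation pos := (le 0).

Lemma le_cone (x y : E) : le x y <-> pos (y - x).
Proof.
split=> h.
  by rewrite -(subrr x); apply: (bl_leD hE).
by rewrite -(add0r x) -[y](subrK x); apply: (bl_leD hE).
Qed.

Lemma le_pos (x y : E) : le x y -> pos (y - x).
Proof. by move/le_cone. Qed.

Lemma pos_le (x y : E) : pos (y - x) -> le x y.
Proof. by move=> h; apply/le_cone. Qed.

Lemma leN_pos (x y : E) : le (- x) y -> pos (y + x).
Proof. by move=> /le_pos; rewrite opprK. Qed.

Lemma pos_leN (x y : E) : pos (y + x) -> le (- x) y.
Proof. by move=> h; apply: pos_le; rewrite opprK. Qed.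

Lemma pos0 : pos 0.
Proof. exact: (bl_refl hE). Qed.

Lemma posD (x y : E) : pos x -> pos y -> pos (x + y).
Proof.
move=> hx hy; apply: (bl_trans hE (y := x)) => //.
by apply: pos_le; rewrite addrAC subrr add0r.
Qed.

Lemma posZ (a : R) (x : E) : 0 <= a -> pos x -> pos (a *: x).
Proof. by move=> a0 hx; rewrite -(scaler0 E a); apply: (bl_leZ hE). Qed.

Lemma pos_anti (x : E) : pos x -> pos (- x) -> x = 0.
Proof.
move=> hx hNx; apply: (bl_anti hE) => //.
by apply: pos_le; rewrite sub0r.
Qed.

Lemma pos_trans (x y : E) : pos x -> pos (y - x) -> pos y.
Proof. by move=> hx h; rewrite -(subrK x y); apply: posD. Qed.

Lemma scale2r_half (V : lmodType R) (x : V) : (2^-1 : R) *: (x + x) = x.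
Proof. by rewrite -mulr2n -[x *+ 2]scaler_nat scalerA mulVf ?scale1r ?pnatr_eq0. Qed.

Lemma pos_half (x : E) : pos (x + x) -> pos x.
Proof. by move=> h; rewrite -[x]scale2r_half; apply: posZ. Qed.

Lemma is_sup_pos_opp (y : E) : pos y -> is_sup setT le [set y; - y] y.
Proof.
move=> hy; split=> // [x [->|->]|u _ hu]; last by apply: hu; left.
  exact: (bl_refl hE).
by apply: pos_leN; apply: posD.
Qed.

(** For any [w] above both [x] and [- x], this decomposition does the work of
    the positive and negative parts of [x] without forming a supremum. *)
Lemma pos_split (x w : E) : pos (w - x) -> pos (w + x) ->
  exists u v, [/\ pos u, pos v, x = u - v & w = u + v].
Proof.
move=> h1 h2; exists (2^-1 *: (w + x)), (2^-1 *: (w - x)).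
split; try by apply: posZ.
  by rewrite -scalerBr opprB addrCA [w + x]addrC addrK scale2r_half.
by rewrite -scalerDr addrACA subrr addr0 scale2r_half.
Qed.

Lemma pos_of_abs (x w : E) : pos (w - x) -> pos (w + x) -> pos w.
Proof.
by move=> h1 h2; have [u [v [hu hv _ ->]]] := pos_split h1 h2; apply: posD.
Qed.

(** Comparing [x] with [y] through the moduli that the norm axiom mentions is
    the same as bounding both [x] and [- x] by [y]. *)
Lemma norm_le_abs (x y : E) : pos (y - x) -> pos (y + x) -> `|x| <= `|y|.
Proof.
move=> h1 h2; have hy := pos_of_abs h1 h2.
have [u hu] := bl_sup hE (x := x) (y := - x) I I.
apply: (bl_le_norm hE _ _ hu (is_sup_pos_opp hy)) => //.
by case: hu => _ _; apply=> // z [->|->]; [apply: pos_le|apply: pos_leN].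
Qed.

Lemma norm_le_pos (x y : E) : pos x -> pos (y - x) -> `|x| <= `|y|.
Proof.
move=> hx h; apply: norm_le_abs => //; apply: posD => //.
exact: pos_trans h.
Qed.

(** The witness is [|x|]; the norm axiom applies in both directions because
    [|x|] is its own modulus. *)
Lemma abs_exists (x : E) :
  exists w, [/\ pos (w - x), pos (w + x) & `|w| = `|x|].
Proof.
have [w hw] := bl_sup hE (x := x) (y := - x) I I; have [_ ub _] := hw.
have h1 : pos (w - x) by apply: le_pos; apply: ub; left.
have h2 : pos (w + x) by apply: leN_pos; apply: ub; right.
exists w; split=> //; apply/eqP; rewrite eq_le (norm_le_abs h1 h2) andbT.
apply: (bl_le_norm hE _ _ (is_sup_pos_opp (pos_of_abs h1 h2)) hw) => //.
exact: (bl_refl hE).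
Qed.

(** For positive [y] the negative part of [x] is below [|y - x|], hence small
    when [y] is close to [x]. *)
Lemma pos_closed (x : E) :
  (forall e : R, 0 < e -> exists2 y, pos y & `|y - x| < e) -> pos x.
Proof.
move=> h; have [n [_ ub lub]] := bl_sup hE (x := - x) (y := 0) I I.
have hn : pos n by apply: ub; right.
have hnx : pos (n + x) by apply: leN_pos; apply: ub; left.
suff n0 : n = 0 by rewrite n0 add0r in hnx.
apply/eqP; rewrite -normr_le0; apply/ler_addgt0Pr => e e0; rewrite add0r.
have [y hy hyx] := h e e0.
have [w [w1 w2 nw]] := abs_exists (y - x).
apply: ltW; apply: le_lt_trans hyx; rewrite -nw; apply: norm_le_pos => //.
apply: le_pos; apply: lub => // z [->|->]; last exact: pos_of_abs w1 w2.
apply: pos_leN; have := posD hy w1.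
by rewrite addrCA opprB [y + _]addrC subrK.
Qed.

(** The piece of [y] below [u] is the infimum of [y] and [u]. *)
Lemma riesz_decomp (u v y : E) : pos u -> pos v -> pos y -> pos (u + v - y) ->
  exists y1 y2, [/\ pos y1, pos (u - y1), pos y2, pos (v - y2) & y = y1 + y2].
Proof.
move=> hu hv hy h; have [m [_ lb glb]] := bl_inf hE (x := y) (y := u) I I.
exists m, (y - m); split.
- by apply: glb => // z [->|->].
- by apply: le_pos; apply: lb; right.
- by apply: le_pos; apply: lb; left.
- suff /le_pos : le (y - v) m by rewrite !opprB addrCA addrA.
  apply: glb => // z [->|->]; apply: pos_le; first by rewrite opprB addrCA subrr addr0.
  by rewrite opprB addrA.
- by rewrite addrC subrK.
Qed.

End Cone.

(** * Bounded operators and the operator norm *)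

Section OperatorNorm.
Variables (R : realType) (E : normedModType R).
Implicit Types (S T : E -> E).

Lemma linear_funD T x y : linear T -> T (x + y) = T x + T y.
Proof. by move=> h; rewrite -[x]scale1r h !scale1r. Qed.

Lemma linear_fun0 T : linear T -> T 0 = 0.
Proof. by move=> h; apply: (addIr (T 0)); rewrite -linear_funD // !add0r. Qed.

Lemma linear_funZ T (a : R) x : linear T -> T (a *: x) = a *: T x.
Proof. by move=> h; rewrite -[a *: x]addr0 h linear_fun0 // addr0. Qed.

Lemma linear_funN T x : linear T -> T (- x) = - T x.
Proof. by move=> h; rewrite -scaleN1r linear_funZ // scaleN1r. Qed.

Lemma linear_funB T x y : linear T -> T (x - y) = T x - T y.
Proof. by move=> h; rewrite linear_funD // linear_funN. Qed.

Lemma linear_cst0 : linear (0 : E -> E).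
Proof. by move=> a x y; rewrite /= scaler0 addr0. Qed.

Lemma linear_addf S T : linear S -> linear T -> linear (S + T).
Proof.
by move=> hS hT a x y; rewrite !fctE hS hT scalerDr addrACA.
Qed.

Lemma linear_scalef (b : R) T : linear T -> linear (b *: T).
Proof.
move=> hT a x y; rewrite !fctE hT scalerDr !scalerA.
by rewrite [b * a]mulrC.
Qed.

Lemma linear_oppf T : linear T -> linear (- T).
Proof. by move=> hT; rewrite -scaleN1r; apply: linear_scalef. Qed.

Lemma linear_subf S T : linear S -> linear T -> linear (S - T).
Proof. by move=> hS hT; apply: linear_addf => //; apply: linear_oppf. Qed.

Lemma linear_comp S T : linear S -> linear T -> linear (S \o T).
Proof. by move=> hS hT a x y /=; rewrite hT hS. Qed.

Lemma L_opP T : L_op T <->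
  linear T /\ exists2 M : R, 0 <= M & forall x, `|T x| <= M * `|x|.
Proof.
split=> -[lT h]; split=> //; pose f : {linear E -> E} :=
  HB.pack T (GRing.isLinear.Build R E E *:%R T lT).
  have /linear_boundedP : bounded_near f (nbhs 0).
    exact: (continuous_linear_bounded (f := f) 0 (h 0)).
  move=> hf; near (+oo : set_system R) => M; exists M => //.
  by near: M.
have [M M0 hM] := h.
apply: (bounded_linear_continuous (f := f)); apply/linear_boundedP.
near=> r => x; apply: le_trans (hM x) _.
by rewrite ler_wpM2r // ltW.
Unshelve. all: by end_near. Qed.

Lemma L_op_linear T : L_op T -> linear T.
Proof. by case. Qed.

Lemma op_norm_has_sup T : L_op T ->
  has_sup [set `|T x| | x in [set x : E | `|x| <= 1]].
Proof.
move=> /L_opP[lT [M M0 hM]]; split.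
  by exists `|T 0|; exists 0 => //=; rewrite normr0 ler01.
exists M => _ [x /= x1 <-]; apply: le_trans (hM x) _.
by rewrite ler_piMr.
Qed.

Lemma op_norm_ge0 T : L_op T -> 0 <= op_norm T.
Proof.
move=> hT; apply: le_trans (sup_upper_bound (op_norm_has_sup hT) _).
  exact: (normr_ge0 (T 0)).
by exists 0 => //=; rewrite normr0 ler01.
Qed.

Lemma op_norm_bound T x : L_op T -> `|T x| <= op_norm T * `|x|.
Proof.
move=> hT; have lT := L_op_linear hT.
have [->|x0] := eqVneq x 0; first by rewrite linear_fun0 // normr0 mulr0.
have nx : 0 < `|x| by rewrite normr_gt0.
rewrite -ler_pdivrMr // mulrC -[X in X * _]gtr0_norm ?invr_gt0 //.
rewrite -normrZ -linear_funZ //.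
apply: (sup_upper_bound (op_norm_has_sup hT)); exists (`|x|^-1 *: x) => //=.
by rewrite normrZ gtr0_norm ?invr_gt0 // mulVf // gt_eqF.
Qed.

Lemma op_norm_le T (M : R) :
  0 <= M -> (forall x, `|T x| <= M * `|x|) -> op_norm T <= M.
Proof.
move=> M0 hM; apply: ge_sup.
  by exists `|T 0|; exists 0 => //=; rewrite normr0 ler01.
move=> _ [x /= x1 <-]; apply: le_trans (hM x) _.
by rewrite ler_piMr.
Qed.

End OperatorNorm.

(** * Domination of operators *)

Section Domination.
Variables (R : realType) (E : normedModType R) (le : E -> E -> Prop).
Hypothesis hE : banach_lattice setT le (fun x : E => `|x|).
Local Notation pos := (le 0).
Implicit Types (S T : E -> E).

(** The relation [|T| <= S], which makes sense before [|T|] is known to exist. *)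
Definition dominated T S : Prop :=
  forall x, pos x -> pos (S x - T x) /\ pos (S x + T x).

Lemma dominatedP T S : dominated T S <-> op_le le T S /\ op_le le (- T) S.
Proof.
split=> [h|[h1 h2] x hx].
  by split=> x /h[h1 h2] //; rewrite /= !fctE opprK.
by split; [exact: h1|have := h2 x hx; rewrite !fctE opprK].
Qed.

Lemma op_le0P T : op_le le 0 T <-> forall x, pos x -> pos (T x).
Proof. by split=> h x /h; rewrite !fctE subr0. Qed.

Lemma dominated_pos T S : dominated T S -> forall x, pos x -> pos (S x).
Proof.
move=> h x /h[h1 h2]; apply: (pos_half hE).
by have := posD hE h1 h2; rewrite addrACA addNr addr0.
Qed.

Lemma dominated_self S : (forall x, pos x -> pos (S x)) -> dominated S S.
Proof.
move=> h x /h hx; split; first by rewrite subrr; exact: (pos0 hE).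
exact: (posD hE).
Qed.

Lemma dominatedD T S T' S' :
  dominated T S -> dominated T' S' -> dominated (T + T') (S + S').
Proof.
move=> h h' x hx; have [h1 h2] := h x hx; have [h1' h2'] := h' x hx.
by rewrite !fctE opprD; split; rewrite addrACA; apply: (posD hE).
Qed.

Lemma dominatedZ (a : R) T S : dominated T S -> dominated (a *: T) (`|a| *: S).
Proof.
move=> h x hx; have [h1 h2] := h x hx; rewrite !fctE.
have [a0|/ltW a0] := ler0P a; last first.
  by rewrite -scalerBr -scalerDr; split; apply: (posZ hE).
have Na : 0 <= - a by rewrite oppr_ge0.
rewrite -[a in a *: T x]opprK [- - a *: _]scaleNr opprK -scalerBr -scalerDr.
by split; apply: (posZ hE).
Qed.

Lemma dominatedN T S : dominated T S -> dominated (- T) S.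
Proof. by move=> h x /h[h1 h2]; rewrite !fctE opprK. Qed.

(** Writing [w = u + v] and [x = u - v] with [u] and [v] positive, [S w - T x]
    is [(S u - T u) + (S v + T v)]. *)
Lemma dominated_abs T S x w : linear T -> linear S -> dominated T S ->
  pos (w - x) -> pos (w + x) -> pos (S w - T x) /\ pos (S w + T x).
Proof.
move=> lT lS h h1 h2; have [u [v [hu hv -> ->]]] := pos_split hE h1 h2.
have [u1 u2] := h u hu; have [v1 v2] := h v hv.
rewrite linear_funD // linear_funB // opprB [T v - _]addrC addrACA.
by rewrite [S u + _ + _]addrACA; split; apply: (posD hE).
Qed.

Lemma dominated_norm T S x : linear T -> L_op S -> dominated T S ->
  `|T x| <= op_norm S * `|x|.
Proof.
move=> lT hS h; have [w [w1 w2 <-]] := abs_exists hE x.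
have [h1 h2] := dominated_abs lT (L_op_linear hS) h w1 w2.
by apply: le_trans (norm_le_abs hE h1 h2) _; apply: op_norm_bound.
Qed.

Lemma dominated_comp T S T' S' : linear T -> linear S ->
  dominated T S -> dominated T' S' -> dominated (T \o T') (S \o S').
Proof.
move=> lT lS h h' x hx; have [h1 h2] := h' x hx.
exact: (dominated_abs lT lS h h1 h2).
Qed.

End Domination.

(** * Classes of operators closed under domination *)

Section Ideals.
Variables (R : realType) (E : normedModType R) (le : E -> E -> Prop).
Hypothesis hE : banach_lattice setT le (fun x : E => `|x|).
Local Notation pos := (le 0).
Implicit Types (S T : E -> E) (P : set (E -> E)).

(** The closure properties shared by the bounded, the Lebesgue and the
    sigma-Lebesgue operators on which the structure of [r_op le P] depends. *)
Record operator_ideal P : Prop := {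
  oi_op : P `<=` @L_op R E ;
  oi0 : P 0 ;
  oiD : forall S T, P S -> P T -> P (S + T) ;
  oiZ : forall (a : R) T, P T -> P (a *: T) ;
  oi_dominated : forall T S, linear T -> P S -> dominated le T S -> P T ;
  oi_comp : forall S T, L_op S -> P T -> P (S \o T) ;
  oi_closed : forall T, linear T ->
    (forall e : R, 0 < e -> exists2 S, P S &
       forall x, `|T x - S x| <= e * `|x|) -> P T }.

(** A test is a family of vectors together with a filter on its index type. As
    the index type varies from test to test, nets and sequences fit the same
    pattern. *)
Definition vanishing (C : forall I : Type, set_system I -> (I -> E) -> Prop) :
    set (E -> E) :=
  [set T | L_op T /\ forall I (F : set_system I) x, C I F x ->
     (fun i => `|T (x i)|) @ F --> (0 : R)].

Lemma L_op_approx T : linear T ->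
  (exists2 S, L_op S & forall x, `|T x - S x| <= `|x|) -> L_op T.
Proof.
move=> lT [S /L_opP[lS [M M0 hM]] hS]; apply/L_opP; split=> //.
exists (1 + M) => [|x]; first by rewrite addr_ge0.
rewrite -[T x](subrK (S x)) mulrDl mul1r.
by apply: le_trans (ler_normD _ _) _; apply: lerD.
Qed.

Lemma cvg_norm0P I (F : set_system I) (f : I -> E) : Filter F ->
  ((fun i => `|f i|) @ F --> (0 : R)) <->
  (forall e : R, 0 < e -> \forall i \near F, `|f i| < e).
Proof. by move=> FF; rewrite norm_cvg0P; apply: cvgr0Pnorm_lt. Qed.

Lemma norm_cvg0_bound I (F : set_system I) (f g : I -> E) (M : R) : Filter F ->
  0 <= M -> (forall i, `|f i| <= M * `|g i|) ->
  (fun i => `|g i|) @ F --> (0 : R) -> (fun i => `|f i|) @ F --> (0 : R).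
Proof.
move=> FF M0 hfg /cvg_norm0P hg; apply/cvg_norm0P => e e0.
have M1 : 0 < M + 1 by lra.
apply: filterS (hg (e / (M + 1)) (divr_gt0 e0 M1)) => i.
rewrite ltr_pdivlMr // mulrC => h; apply: le_lt_trans (hfg i) _.
by apply: le_lt_trans h; rewrite ler_wpM2r // lerDl.
Qed.

(** Along a family of positive vectors domination passes to norms, and along an
    eventually bounded one convergence to [0] is preserved by uniform limits. *)
Lemma vanishing_ideal (C : forall I : Type, set_system I -> (I -> E) -> Prop) :
  (forall I (F : set_system I) x, C I F x ->
     [/\ Filter F, forall i, pos (x i) &
         exists M : R, \forall i \near F, `|x i| <= M]) ->
  operator_ideal (vanishing C).
Proof.
move=> hC; split.
- by move=> T [].
- split=> [|I F x]; last first.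
    move=> /hC[FF _ _]; rewrite [X in X @ _](_ : _ = cst 0) ?funeqE; last first.
      by move=> i; rewrite normr0.
    exact: cvg_cst.
  apply/L_opP; split; first exact: linear_cst0.
  by exists 0 => // x; rewrite normr0 mul0r.
- move=> S T [/L_opP[lS [M M0 hM]] vS] [/L_opP[lT [N N0 hN]] vT]; split.
    apply/L_opP; split; first exact: linear_addf.
    exists (M + N) => [|x]; first exact: addr_ge0.
    by rewrite mulrDl; apply: le_trans (ler_normD _ _) _; apply: lerD.
  move=> I F x Cx; have [FF _ _] := hC _ _ _ Cx.
  apply/cvg_norm0P => e e0.
  have e2 : 0 < e / 2 by lra.
  have /cvg_norm0P /(_ _ e2) h1 := vS _ _ _ Cx.
  have /cvg_norm0P /(_ _ e2) h2 := vT _ _ _ Cx.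
  apply: filterS2 h1 h2 => i h1 h2.
  apply: le_lt_trans (ler_normD _ _) _; lra.
- move=> a T [/L_opP[lT [M M0 hM]] vT]; split.
    apply/L_opP; split; first exact: linear_scalef.
    exists (`|a| * M) => [|x]; first exact: mulr_ge0.
    by rewrite normrZ -mulrA ler_wpM2l.
  move=> I F x Cx; have [FF _ _] := hC _ _ _ Cx.
  apply: (norm_cvg0_bound (M := `|a|)) (vT _ _ _ Cx) => // i.
  by rewrite normrZ.
- move=> T S lT [hS vS] h; split.
    apply/L_opP; split=> //; exists (op_norm S); first exact: op_norm_ge0.
    by move=> x; apply: (dominated_norm hE).
  move=> I F x Cx; have [FF px _] := hC _ _ _ Cx.
  apply: (norm_cvg0_bound (M := 1)) (vS _ _ _ Cx) => // i; rewrite mul1r.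
  by have [h1 h2] := h _ (px i); apply: (norm_le_abs hE).
- move=> S T /L_opP[lS [M M0 hM]] [/L_opP[lT [N N0 hN]] vT]; split.
    apply/L_opP; split; first exact: linear_comp.
    exists (M * N) => [|x]; first exact: mulr_ge0.
    by apply: le_trans (hM _) _; rewrite -mulrA ler_wpM2l.
  move=> I F x Cx; have [FF _ _] := hC _ _ _ Cx.
  by apply: (norm_cvg0_bound (M := M)) (vT _ _ _ Cx) => // i; apply: hM.
- move=> T lT h; split.
    have [S [hS _] hTS] := h 1 ltr01; apply: L_op_approx => //.
    by exists S => // x; rewrite -[`|x|]mul1r.
  move=> I F x Cx; have [FF _ [M hM]] := hC _ _ _ Cx.
  apply/cvg_norm0P => e e0; have e2 : 0 < e / 2 by lra.
  have M1 : 0 < `|M| + 1 by rewrite ltr_wpDl.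
  have [S [_ vS] hTS] := h _ (divr_gt0 e2 M1).
  have /cvg_norm0P /(_ _ e2) hSx := vS _ _ _ Cx.
  apply: filterS2 hM hSx => i xM Sx.
  rewrite -[T _](subrK (S (x i))); apply: le_lt_trans (ler_normD _ _) _.
  suff : `|T (x i) - S (x i)| <= e / 2 by lra.
  apply: le_trans (hTS _) _; rewrite -mulrA -[leRHS]mulr1 ler_wpM2l //; first exact: ltW.
  rewrite mulrC ler_pdivrMr // mul1r; have := ler_norm M; lra.
Qed.

(** Without any test, [vanishing] is the class of bounded operators. *)
Definition no_test I (F : set_system I) (x : I -> E) : Prop := False.

Inductive net_test : forall I : Type, set_system I -> (I -> E) -> Prop :=
  NetTest I (r : I -> I -> Prop) x of directed r & net_decr0 le r x :
    net_test (net_tails r) x.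

Inductive seq_test : forall I : Type, set_system I -> (I -> E) -> Prop :=
  SeqTest (x : nat -> E) of seq_decr0 le x : seq_test \oo x.

Lemma net_tails_filter (I : Type) (r : I -> I -> Prop) :
  directed r -> Filter (net_tails r).
Proof.
move=> [[i0] rr rt ru]; apply: filter_from_filter; first by exists i0.
move=> i j _ _; have [k [ik jk]] := ru i j; exists k => // l /= kl.
by split; apply: rt kl.
Qed.

Lemma decr0_pos (I : Type) (x : I -> E) i :
  is_inf setT le (range x) 0 -> pos (x i).
Proof. by move=> [_ lb _]; apply: lb; exists i. Qed.

Lemma L_op_ideal : operator_ideal (@L_op R E).
Proof.
have -> : @L_op R E = vanishing no_test; last exact: vanishing_ideal.
by apply/seteqP; split=> T; [|case].
Qed.

Lemma L_Leb_ideal : operator_ideal (L_Leb le).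
Proof.
have -> : L_Leb le = vanishing net_test.
  apply/seteqP; split=> T [hT h]; split=> // I F x; first by case.
  by move=> dF dx; apply: h; constructor.
apply: vanishing_ideal => _ _ _ [I r x dr [dx ix]]; split.
- exact: net_tails_filter.
- by move=> i; apply: decr0_pos ix.
- have [[i0] rr _ _] := dr; exists `|x i0|; exists i0 => // j /= ij.
  apply: (norm_le_pos hE); first exact: decr0_pos ix.
  by apply: (le_pos hE); apply: dx.
Qed.

Lemma L_sLeb_ideal : operator_ideal (L_sLeb le).
Proof.
have -> : L_sLeb le = vanishing seq_test.
  apply/seteqP; split=> T [hT h]; split=> //; last by move=> x dx; apply: h.
  by move=> I F x; case => {}x; apply: h.
apply: vanishing_ideal => _ _ _ [x [dx ix]]; split.
- exact: eventually_filter.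
- by move=> i; apply: decr0_pos ix.
- exists `|x 0%N|; near=> n; apply: (norm_le_pos hE); first exact: decr0_pos ix.
  by apply: (le_pos hE); apply: dx.
Unshelve. all: by end_near. Qed.

End Ideals.

(** * Differences of positive operators and the regular norm *)

Section RegularIdeal.
Variables (R : realType) (E : normedModType R) (le : E -> E -> Prop).
Hypothesis hE : banach_lattice setT le (fun x : E => `|x|).
Variable P : set (E -> E).
Hypothesis hP : operator_ideal le P.
Local Notation pos := (le 0).
Local Notation J := (r_op le P).
Local Notation N := (r_norm le P).
Implicit Types (S T : E -> E).

Let P_linear S : P S -> linear S.
Proof. by move=> /(oi_op hP)/L_op_linear. Qed.

(** From a difference [T1 - T2] the dominating operator is [T1 + T2]. Conversely
    the terms [(S + T) / 2] and [(S - T) / 2] are positive and dominated by [S],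
    so they are in [P] as [S] is. *)
Lemma r_opP T : J T <-> linear T /\ exists2 S, P S & dominated le T S.
Proof.
split=> [[T1 [T2 [P1 P2 /op_le0P p1 /op_le0P p2 ->]]]|[lT [S PS h]]].
  split; first by apply: linear_subf; apply: P_linear.
  exists (T1 + T2); first exact: (oiD hP).
  apply: (dominatedD hE); first exact: (dominated_self hE).
  by apply: dominatedN; apply: (dominated_self hE).
have lS := P_linear PS.
have key U : linear U -> dominated le U S ->
    P (2^-1 *: (S + U)) /\ op_le le 0 (2^-1 *: (S + U)).
  move=> lU hU.
  have pU x : pos x -> pos ((2^-1 *: (S + U)) x).
    by move=> /hU[_ h2]; rewrite !fctE; apply: (posZ hE).
  split; last exact/op_le0P.
  apply: (oi_dominated hP (S := S)) => // [|x hx].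
    by apply: linear_scalef; apply: linear_addf.
  split; last by apply: (posD hE); [exact: (dominated_pos hE hU)|exact: pU].
  have [h1 _] := hU x hx; rewrite !fctE.
  rewrite -{1}[S x]scale2r_half -scalerBr opprD addrACA subrr add0r.
  exact: (posZ hE).
have [P1 p1] := key T lT h; have [P2 p2] := key (- T) (linear_oppf lT) (dominatedN h).
exists (2^-1 *: (S + T)), (2^-1 *: (S - T)); split=> //.
by rewrite -scalerBr opprB addrCA [S + T]addrC addrK scale2r_half.
Qed.

Lemma r_op_linear T : J T -> linear T.
Proof. by case/r_opP. Qed.

Lemma r_op_sub_L_r : J `<=` L_r le.
Proof.
move=> _ [T1 [T2 [P1 P2 p1 p2 ->]]]; exists T1, T2.
by split=> //; apply: (oi_op hP).
Qed.

Lemma r_op0 : J 0.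
Proof.
apply/r_opP; split; first exact: linear_cst0.
exists 0; first exact: (oi0 hP).
by apply: (dominated_self hE) => x _; apply: (pos0 hE).
Qed.

Lemma r_opD S T : J S -> J T -> J (S + T).
Proof.
move=> /r_opP[lS [A PA hA]] /r_opP[lT [B PB hB]]; apply/r_opP.
split; first exact: linear_addf.
by exists (A + B); [exact: (oiD hP)|exact: (dominatedD hE)].
Qed.

Lemma r_opZ (a : R) T : J T -> J (a *: T).
Proof.
move=> /r_opP[lT [A PA hA]]; apply/r_opP; split; first exact: linear_scalef.
by exists (`|a| *: A); [exact: (oiZ hP)|exact: (dominatedZ hE)].
Qed.

Lemma r_opN T : J T -> J (- T).
Proof. by rewrite -scaleN1r; apply: r_opZ. Qed.

Lemma r_op_submod : GRing.submod_closed (mem J).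
Proof.
split; first by rewrite inE; exact: r_op0.
by move=> a S T; rewrite !inE => hS hT; apply: r_opD => //; apply: r_opZ.
Qed.

(** ** The regular norm *)

Let dominating T := [set S | [/\ P S, op_le le T S & op_le le (- T) S]].

Let dominating_lbound T : has_lbound [set op_norm S | S in dominating T].
Proof. by exists 0 => _ [S [PS _ _] <-]; apply/op_norm_ge0/(oi_op hP). Qed.

Lemma r_norm_le T S : P S -> dominated le T S -> N T <= op_norm S.
Proof.
move=> PS /dominatedP[h1 h2]; apply: ge_inf; first exact: dominating_lbound.
by exists S.
Qed.

Let dominating_nonempty T : J T -> [set op_norm S | S in dominating T] !=set0.
Proof.
move=> /r_opP[_ [S PS /dominatedP[h1 h2]]].
by exists (op_norm S), S.
Qed.

Lemma r_norm_ge T (M : R) : J T ->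
  (forall S, P S -> dominated le T S -> M <= op_norm S) -> M <= N T.
Proof.
move=> hT h; apply: lb_le_inf; first exact: dominating_nonempty.
by move=> _ [S [PS h1 h2] <-]; apply: h => //; apply/dominatedP.
Qed.

Lemma r_norm_ge0 T : J T -> 0 <= N T.
Proof. by move=> hT; apply: r_norm_ge => // S /(oi_op hP)/op_norm_ge0. Qed.

Lemma r_norm_approx T (e : R) : J T -> N T < e ->
  exists S, [/\ P S, dominated le T S & op_norm S < e].
Proof.
move=> hT he; have e0 : 0 < e - N T by rewrite subr_gt0.
have [] := inf_adherent e0 (E := [set op_norm S | S in dominating T]).
  by split; [exact: dominating_nonempty|exact: dominating_lbound].
move=> _ [S [PS h1 h2] <-]; rewrite addrC subrK => h.
by exists S; split=> //; apply/dominatedP.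
Qed.

Lemma r_norm_bound T x : J T -> `|T x| <= N T * `|x|.
Proof.
move=> hT; have [->|x0] := eqVneq x 0.
  by rewrite (linear_fun0 (r_op_linear hT)) normr0 mulr0.
have nx : 0 < `|x| by rewrite normr_gt0.
rewrite -ler_pdivrMr //; apply: r_norm_ge => // S PS h.
rewrite ler_pdivrMr //; apply: (dominated_norm hE) => //.
  exact: r_op_linear.
exact: (oi_op hP).
Qed.

Lemma r_norm0 T : J T -> N T = 0 -> T = 0.
Proof.
move=> hT T0; apply/funext => x; apply/eqP; rewrite -normr_le0.
by have := r_norm_bound x hT; rewrite T0 mul0r.
Qed.

Lemma r_normD S T : J S -> J T -> N (S + T) <= N S + N T.
Proof.
move=> hS hT; apply/ler_addgt0Pr => e e0.
have e2 : 0 < e / 2 by rewrite divr_gt0.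
have [A [PA dA nA]] := @r_norm_approx S (N S + e / 2) hS ltac:(by rewrite ltrDl).
have [B [PB dB nB]] := @r_norm_approx T (N T + e / 2) hT ltac:(by rewrite ltrDl).
have oA := oi_op hP PA; have oB := oi_op hP PB.
apply: le_trans (r_norm_le (oiD hP PA PB) (dominatedD hE dA dB)) _.
apply: (@le_trans _ _ (op_norm A + op_norm B)); last by lra.
apply: op_norm_le => [|x]; first by apply: addr_ge0; apply: op_norm_ge0.
rewrite mulrDl; apply: le_trans (ler_normD _ _) _.
by apply: lerD; apply: op_norm_bound.
Qed.

Lemma op_normZ_le (a : R) S : L_op S -> op_norm (a *: S) <= `|a| * op_norm S.
Proof.
move=> oS; apply: op_norm_le => [|x].
  by rewrite mulr_ge0 // op_norm_ge0.
by rewrite normrZ -mulrA ler_wpM2l // op_norm_bound.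
Qed.

Lemma r_normZ (a : R) T : J T -> N (a *: T) = `|a| * N T.
Proof.
have half (b : R) U : b != 0 -> J U -> N (b *: U) <= `|b| * N U.
  move=> b0 hU; rewrite mulrC -ler_pdivrMr ?normr_gt0 //.
  apply: r_norm_ge => // S PS dS; rewrite ler_pdivrMr ?normr_gt0 // mulrC.
  apply: le_trans (r_norm_le (oiZ hP `|b| PS) (dominatedZ hE b dS)) _.
  by rewrite -[X in X * _]normr_id; apply: op_normZ_le; apply: (oi_op hP).
move=> hT; have [->|a0] := eqVneq a 0.
  rewrite scale0r normr0 mul0r; apply/eqP; rewrite eq_le r_norm_ge0 ?andbT.
    have := r_norm_le (oi0 hP) (dominated_self hE (S := 0) (fun x _ => pos0 hE)).
    move=> h; apply: le_trans h _; apply: op_norm_le => // x.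
    by rewrite normr0 mul0r.
  exact: r_op0.
apply/eqP; rewrite eq_le half //= -ler_pdivlMl ?normr_gt0 //.
rewrite -{1}[T](scalerK a0) -normfV; apply: half; first by rewrite invr_eq0.
exact: r_opZ.
Qed.

(** The norm of [A \o B], for dominating [A] and [B], bounds that of [S \o T];
    the infimum is taken over [B] and then over [A]. A vanishing factor, by which
    one cannot divide, is treated apart. *)
Lemma r_normM S T : J S -> J T -> N (S \o T) <= N S * N T.
Proof.
move=> hS hT.
have step A : P A -> dominated le S A -> N (S \o T) <= op_norm A * N T.
  move=> PA dA; have oA := oi_op hP PA.
  have dAT B : P B -> dominated le T B -> N (S \o T) <= op_norm A * op_norm B.
    move=> PB dB; have oB := oi_op hP PB.
    apply: le_trans (r_norm_le (oi_comp hP oA PB) _) _.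
      by apply: (dominated_comp hE) => //; [exact: r_op_linear|exact: P_linear].
    apply: op_norm_le => [|x]; first by rewrite mulr_ge0 // op_norm_ge0.
    apply: le_trans (op_norm_bound _ oA) _; rewrite -mulrA.
    by rewrite ler_wpM2l ?op_norm_ge0 // op_norm_bound.
  have := op_norm_ge0 oA; rewrite le_eqVlt => /orP[/eqP A0|A0].
    have /r_opP[_ [B PB dB]] := hT.
    by have := dAT B PB dB; rewrite -A0 !mul0r.
  rewrite mulrC -ler_pdivrMr //; apply: r_norm_ge => // B PB dB.
  by rewrite ler_pdivrMr // mulrC dAT.
have := r_norm_ge0 hT; rewrite le_eqVlt => /orP[/eqP T0|T0].
  have /r_opP[_ [A PA dA]] := hS.
  by have := step A PA dA; rewrite -T0 !mulr0.
rewrite -ler_pdivrMr //; apply: r_norm_ge => // A PA dA.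
by rewrite ler_pdivrMr // step.
Qed.

(** The moduli of [S] and [T] enter only through their universal property: an
    operator of [P] that dominates [T] is above [|T|], hence above [|S|]. *)
Lemma r_norm_le_abs S T u v : J S -> J T ->
  is_sup J (op_le le) [set S; - S] u -> is_sup J (op_le le) [set T; - T] v ->
  op_le le u v -> N S <= N T.
Proof.
move=> hS hT [Ju ubu _] [Jv ubv lubv] uv; apply: r_norm_ge => // A PA dA.
have JA : J A.
  apply/r_opP; split; first exact: P_linear.
  by exists A => //; apply: (dominated_self hE); apply: (dominated_pos hE dA).
have vA : op_le le v A.
  by move/dominatedP: dA => [h1 h2]; apply: lubv => // x [->|->].
have opT (X Y Z : E -> E) : op_le le X Y -> op_le le Y Z -> op_le le X Z.
  move=> h1 h2 x hx; have := posD hE (h2 x hx) (h1 x hx).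
  by rewrite !fctE addrA subrK.
have uA := opT _ _ _ uv vA.
apply: r_norm_le => //; apply/dominatedP; split; apply: opT uA; apply: ubu.
  by left.
by right.
Qed.

End RegularIdeal.

Section LeftIdeal.
Variables (R : realType) (E : normedModType R) (le : E -> E -> Prop).
Hypothesis hE : banach_lattice setT le (fun x : E => `|x|).

Lemma r_op_comp (P : set (E -> E)) (S T : E -> E) : operator_ideal le P ->
  L_r le S -> r_op le P T -> r_op le P (S \o T).
Proof.
move=> hP /(r_opP hE (L_op_ideal hE))[lS [A oA dA]] /(r_opP hE hP)[lT [B PB dB]].
apply/(r_opP hE hP); split; first exact: linear_comp.
exists (A \o B); first exact: (oi_comp hP).
by apply: (dominated_comp hE) => //; apply: L_op_linear.
Qed.

Lemma r_op_left_ideal (P : set (E -> E)) : operator_ideal le P ->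
  left_algebraic_ideal le (r_op le P).
Proof.
move=> hP; split; [exact: r_op_sub_L_r|exact: r_op_submod|].
by move=> S T; apply: r_op_comp.
Qed.

Lemma left_ideal_subalgebra (J : set (E -> E)) :
  left_algebraic_ideal le J -> subalgebra le J.
Proof. by move=> [sJ mJ cJ]; split=> // S T /sJ; apply: cJ. Qed.

End LeftIdeal.

(** * The Riesz-Kantorovich formula *)

Section RieszKantorovich.
Variables (R : realType) (E : normedModType R) (le : E -> E -> Prop).
Hypothesis hE : banach_lattice setT le (fun x : E => `|x|).
Local Notation pos := (le 0).
Implicit Types (S T : E -> E).

Lemma pos_generating (x : E) : exists u v, [/\ pos u, pos v & x = u - v].
Proof.
have [w [w1 w2 _]] := abs_exists hE x.
by have [u [v [hu hv xE _]]] := pos_split hE w1 w2; exists u, v.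
Qed.

(** Additivity on the cone makes [p u - p v] depend only on [u - v]. *)
Lemma cone_extension (p : E -> E) :
  (forall u v, pos u -> pos v -> p (u + v) = p u + p v) ->
  (forall (a : R) u, 0 <= a -> pos u -> p (a *: u) = a *: p u) ->
  exists Q : E -> E, linear Q /\ forall u, pos u -> Q u = p u.
Proof.
move=> pD pZ.
have /choice[s hs] : forall x, exists uv : E * E,
    [/\ pos uv.1, pos uv.2 & x = uv.1 - uv.2].
  by move=> x; have [u [v h]] := pos_generating x; exists (u, v).
pose Q x := p (s x).1 - p (s x).2.
have QE u v : pos u -> pos v -> Q (u - v) = p u - p v.
  move=> hu hv; rewrite /Q; have [h1 h2 e] := hs (u - v).
  move: (s (u - v)) h1 h2 e => [a b] /= ha hb e.
  have : a + v = u + b by rewrite -[u](subrK v) e addrAC subrK addrC.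
  move=> /(congr1 p); rewrite !pD // => epp.
  by rewrite -[p a](addrK (p v)) epp addrAC addrK.
have p0 : p 0 = 0.
  by rewrite -(scale0r (0 : E)) pZ ?scale0r //; exact: (pos0 hE).
exists Q; split=> [a x y|u hu]; last first.
  by rewrite -[u in LHS]subr0 QE ?p0 ?subr0 //; exact: (pos0 hE).
have [u [v [hu hv ->]]] := pos_generating x.
have [u' [v' [hu' hv' ->]]] := pos_generating y.
rewrite !QE //; have [a0|/ltW a0] := ler0P a; last first.
  have -> : a *: (u - v) + (u' - v') = (a *: u + u') - (a *: v + v').
    by rewrite scalerBr opprD addrACA.
  rewrite QE ?pD ?pZ //; try by do ?apply: (posD hE); do ?apply: (posZ hE).
  by rewrite scalerBr opprD addrACA.
have Na : 0 <= - a by rewrite oppr_ge0.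
have -> : a *: (u - v) + (u' - v') = (- a *: v + u') - (- a *: u + v').
  by rewrite !scaleNr scalerBr opprD opprK [RHS]addrACA [- _ + a *: _]addrC.
rewrite QE ?pD ?pZ //; try by do ?apply: (posD hE); do ?apply: (posZ hE).
by rewrite !scaleNr scalerBr opprD opprK [LHS]addrACA [- _ + a *: _]addrC.
Qed.

(** On the cone the positive part of [T] is [x |-> sup T [0, x]]; the Riesz
    decomposition property makes it additive. The operator [A] serves to
    bound the sets [T [0, x]]. *)
Lemma riesz_kantorovich T A : dedekind_complete setT le ->
  linear T -> linear A ->
  (forall x, pos x -> pos (A x)) -> (forall x, pos x -> pos (A x - T x)) ->
  exists Q : E -> E, [/\ linear Q, forall x, pos x -> pos (Q x),
    forall x, pos x -> pos (Q x - T x)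
    & forall U : E -> E, linear U -> (forall x, pos x -> pos (U x)) ->
        (forall x, pos x -> pos (U x - T x)) ->
        forall x, pos x -> pos (U x - Q x)].
Proof.
move=> dc lT lA pA pAT.
pose D x := [set T y | y in [set y | pos y /\ pos (x - y)]].
have Dub U : linear U -> (forall x, pos x -> pos (U x)) ->
    (forall x, pos x -> pos (U x - T x)) ->
    forall x z, D x z -> le z (U x).
  move=> lU pU pUT x _ [y [hy hxy] <-]; apply: (pos_le hE).
  rewrite -[U x](subrK (U y)) -linear_funB // -addrA.
  by apply: (posD hE); [exact: pU|exact: pUT].
have /choice[p hp] : forall x, exists s, pos x -> is_sup setT le (D x) s.
  move=> x; have [hx|nx] := pselect (pos x); last by exists 0 => /nx.
  have [||s hs] := dc (D x) (fun _ _ => I); last by exists s.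
    by exists (T 0), 0 => //=; rewrite subr0; split=> //; exact: (pos0 hE).
  by exists (A x) => //; apply: Dub.
have pub x y : pos x -> pos y -> pos (x - y) -> pos (p x - T y).
  move=> hx hy hxy; apply: (le_pos hE); have [_ ub _] := hp x hx.
  by apply: ub; exists y.
have plub x u : pos x -> (forall y, pos y -> pos (x - y) -> pos (u - T y)) ->
    pos (u - p x).
  move=> hx h; apply: (le_pos hE); have [_ _ lub] := hp x hx.
  by apply: lub => // _ [y [hy hxy] <-]; apply: (pos_le hE); apply: h.
(* One inequality is the Riesz decomposition; the other takes two suprema in
   turn, over [y1] below [u] and then over [y2] below [v]. *)
have pD u v : pos u -> pos v -> p (u + v) = p u + p v.
  move=> hu hv; have huv := posD hE hu hv.
  apply/eqP; rewrite -subr_eq0; apply/eqP/(pos_anti hE); last first.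
    rewrite opprB; apply: plub => // y hy /(riesz_decomp hE hu hv hy).
    move=> [y1 [y2 [h1 h1' h2 h2' ->]]].
    by rewrite linear_funD // opprD addrACA; apply: (posD hE); apply: pub.
  rewrite opprD [- _ - _]addrC addrA; apply: (plub) => // y1 hy1 uy1.
  rewrite addrAC; apply: plub => // y2 hy2 vy2.
  rewrite -addrA -opprD -linear_funD //; apply: pub => //; first exact: (posD hE).
  by rewrite opprD addrACA; apply: (posD hE).
have p0 : p 0 = 0.
  by apply: (addrI (p 0)); rewrite -pD ?addr0 //; exact: (pos0 hE).
have pZ_le (a : R) u : 0 < a -> pos u -> pos (a *: p u - p (a *: u)).
  move=> a0 hu; have a1 := ltW a0; apply: plub => [|y hy huy].
    exact: (posZ hE).
  have -> : a *: p u - T y = a *: (p u - T (a^-1 *: y)).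
    by rewrite scalerBr (linear_funZ _ _ lT) scalerA divff ?scale1r ?gt_eqF.
  apply: (posZ hE) => //; apply: pub => //.
    by apply: (posZ hE) => //; rewrite invr_ge0.
  rewrite -[u](scalerK (lt0r_neq0 a0)) -scalerBr.
  by apply: (posZ hE) => //; rewrite invr_ge0.
(* The reverse inequality is [pZ_le] for [a^-1] and [a *: u]. *)
have pZ (a : R) u : 0 <= a -> pos u -> p (a *: u) = a *: p u.
  rewrite le_eqVlt => /orP[/eqP<- _|a0 hu]; first by rewrite !scale0r p0.
  apply/esym/eqP; rewrite -subr_eq0; apply/eqP/(pos_anti hE).
    exact: pZ_le.
  have a1 : 0 < a^-1 by rewrite invr_gt0.
  have := pZ_le _ _ a1 (posZ hE (ltW a0) hu).
  rewrite scalerK ?gt_eqF // => /(posZ hE (ltW a0)).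
  by rewrite scalerBr scalerA divff ?gt_eqF // scale1r opprB.
have [Q [lQ Qp]] := cone_extension pD pZ.
exists Q; split=> // [x hx|x hx|U lU pU pUT x hx]; rewrite Qp //.
- by have := pub x 0 hx (pos0 hE); rewrite (linear_fun0 lT) !subr0; apply.
- by apply: pub => //; rewrite subrr; exact: (pos0 hE).
- by apply: plub => // y hy hxy; apply: (le_pos hE); apply: Dub => //; exists y.
Qed.

End RieszKantorovich.

(** * Lattice operations of regular operators *)

Section RegularLattice.
Variables (R : realType) (E : normedModType R) (le : E -> E -> Prop).
Hypothesis hE : banach_lattice setT le (fun x : E => `|x|).
Hypothesis dc : dedekind_complete setT le.
Variable P : set (E -> E).
Hypothesis hP : operator_ideal le P.
Local Notation pos := (le 0).
Local Notation J := (r_op le P).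
Implicit Types (S T : E -> E).

(** [S + (T - S)^+] is the least upper bound among all linear maps, hence the
    same for every [P]; this is what allows comparing regular norms. *)
Lemma r_op_join S T : J S -> J T ->
  exists U, [/\ J U, op_le le S U, op_le le T U
    & forall V, linear V -> op_le le S V -> op_le le T V -> op_le le U V].
Proof.
move=> hS hT; have hD : J (T - S).
  by apply: (r_opD hE hP) => //; apply: (r_opN hE hP).
have lS := r_op_linear hE hP hS; have lT := r_op_linear hE hP hT.
have [A PA dA] := ((r_opP hE hP _).1 hD).2; have lA := L_op_linear (oi_op hP PA).
have [|Q [lQ pQ pQD Qmin]] :=
    riesz_kantorovich hE dc (linear_subf lT lS) lA (dominated_pos hE dA).
  by move=> x /dA[].
have JQ : J Q.
  apply/(r_opP hE hP); split=> //; exists A => // x hx; split; last first.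
    by apply: (posD hE); [exact: (dominated_pos hE dA)|exact: pQ].
  apply: (Qmin A) => // [|y /dA[] //]; exact: (dominated_pos hE dA).
exists (S + Q); split=> [||x hx|V lV SV TV x hx].
- exact: (r_opD hE hP).
- by move=> x /pQ; rewrite !fctE addrAC subrr add0r.
- by have := pQD x hx; rewrite !fctE opprB addrA [Q x + _]addrC.
have := Qmin (V - S) (linear_subf lV lS) SV _ x hx.
rewrite !fctE opprD addrA; apply=> y /TV.
by rewrite !fctE opprB addrA subrK.
Qed.

Lemma r_op_sup S T : J S -> J T ->
  exists U, is_sup J (op_le le) [set S; T] U.
Proof.
move=> hS hT; have [U [JU SU TU Umin]] := r_op_join hS hT; exists U; split=> //.
  by move=> x [->|->].
move=> V /(r_op_linear hE hP) lV h.
by apply: Umin => //; apply: h; [left|right].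
Qed.

Lemma op_leN2 S T : op_le le (- S) (- T) -> op_le le T S.
Proof. by move=> h x /h; rewrite !fctE opprK addrC. Qed.

Lemma r_op_inf S T : J S -> J T ->
  exists U, is_inf J (op_le le) [set S; T] U.
Proof.
move=> hS hT; have [U [JU ub lub]] := r_op_sup (r_opN hE hP hS) (r_opN hE hP hT).
exists (- U); split=> [|x hx|V JV h]; first exact: (r_opN hE hP).
  apply: op_leN2; rewrite opprK; apply: ub.
  by case: hx => ->; [left|right].
apply: op_leN2; rewrite opprK; apply: lub => [|x [->|->]].
- exact: (r_opN hE hP).
- by apply: op_leN2; rewrite !opprK; apply: h; left.
- by apply: op_leN2; rewrite !opprK; apply: h; right.
Qed.

(** A bounded operator that dominates [T] is above [|T|], and [|T|] itself lies
    in [P] because some element of [P] dominates [T]. *)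
Lemma r_norm_L_op T : J T -> r_norm le P T = r_norm le (@L_op R E) T.
Proof.
move=> hT; have hL := L_op_ideal hE.
have LT : r_op le (@L_op R E) T by apply: (r_op_sub_L_r hP).
apply/eqP; rewrite eq_le; apply/andP; split; last first.
  by apply: (r_norm_ge hE hP) => // S /(oi_op hP) oS dS; apply: (r_norm_le hL).
apply: (r_norm_ge hE hL) => // S oS dS.
have [U [JU TU NTU Umin]] := r_op_join hT (r_opN hE hP hT).
have lU := r_op_linear hE hP JU.
have dTU : dominated le T U by apply/dominatedP.
have dU V : linear V -> dominated le T V -> dominated le U V.
  move=> lV dV x hx; have /dominatedP[h1 h2] := dV.
  split; first exact: Umin.
  apply: (posD hE); first exact: (dominated_pos hE dV).
  exact: (dominated_pos hE dTU).
have [B PB dB] := ((r_opP hE hP _).1 hT).2.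
have PU : P U.
  by apply: (oi_dominated hP lU PB); apply: dU => //; apply/L_op_linear/(oi_op hP).
apply: le_trans (r_norm_le hP PU dTU) _.
apply: op_norm_le => [|x]; first exact: op_norm_ge0.
by apply: (dominated_norm hE) => //; apply: dU => //; apply: L_op_linear.
Qed.

End RegularLattice.

(** An operator that dominates another one is positive, and a positive operator
    is regular if and only if it is bounded. *)
Lemma r_norm_L_r (R : realType) (E : normedModType R) (le : E -> E -> Prop)
    (hE : banach_lattice setT le (fun x : E => `|x|)) (T : E -> E) :
  r_norm le (L_r le) T = r_norm le (@L_op R E) T.
Proof.
have hL := L_op_ideal hE.
rewrite /r_norm; congr (inf (_ @` _)); apply/seteqP; split=> S [hS h1 h2]; split=> //.
  have [S1 [S2 [L1 L2 _ _ ->]]] := hS.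
  by apply: (oiD hL) => //; rewrite -scaleN1r; apply: (oiZ hL).
have dS : dominated le T S by apply/dominatedP.
apply/(r_opP hE hL); split; first exact: L_op_linear.
by exists S => //; apply: (dominated_self hE); apply: (dominated_pos hE dS).
Qed.

(** * Completeness of the regular norm *)

Section Completeness.
Variables (R : realType) (E : normedModType R) (le : E -> E -> Prop).
Hypothesis hE : banach_lattice setT le (fun x : E => `|x|).
Local Notation pos := (le 0).
Implicit Types (S T : E -> E).

Let geom n : R := 2^-1 ^+ n.

Let geom_gt0 n : 0 < geom n.
Proof. by rewrite exprn_gt0 // invr_gt0. Qed.

Let geom_half n : geom n = geom n.+1 + geom n.+1.
Proof. by rewrite /geom exprS; lra. Qed.

Let geom_small (e : R) : 0 < e -> exists n, forall m, (n <= m)%N -> geom m < e.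
Proof.
move=> e0; have : geom @ \oo --> (0 : R).
  by apply: cvg_expr; rewrite ger0_norm ?invr_ge0 // invf_lt1 // ltr1n.
move=> /cvgr0Pnorm_lt /(_ e e0)[n _ hn]; exists n => m nm.
by have := hn m nm; rewrite gtr0_norm.
Qed.

(** The limit is taken pointwise, and the bound on the remainders makes it an
    approximation in operator norm. *)
Lemma op_series (D : nat -> E -> E) : (forall n, linear (D n)) ->
  (forall n x, `|D n x| <= geom n * `|x|) ->
  exists G, linear G /\
    forall k x, `|G x - (\sum_(0 <= j < k) D j) x| <= geom k * 2 * `|x|.
Proof.
move=> lD bD; pose p k x := \sum_(0 <= j < k) D j x.
have pE k x : (\sum_(0 <= j < k) D j) x = p k x.
  by rewrite fct_sumE.
(* The bound telescopes since [geom j = 2 * geom j - 2 * geom (j + 1)]. *)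
have ptail k i x : `|p (k + i)%N x - p k x| <= (geom k * 2 - geom (k + i)%N * 2) * `|x|.
  elim: i => [|i IHi]; first by rewrite addn0 !subrr mul0r normr0.
  rewrite addnS {1}/p big_nat_recr //= -/(p _ x) addrAC.
  apply: le_trans (ler_normD _ _) _; apply: le_trans (lerD IHi (bD _ _)) _.
  by rewrite -mulrDl ler_wpM2r // [geom (k + i)%N]geom_half; lra.
have ptail2 k n x : (k <= n)%N -> `|p n x - p k x| <= geom k * 2 * `|x|.
  move=> kn; have := ptail k (n - k)%N x; rewrite subnKC // => hk.
  apply: le_trans hk _; rewrite ler_wpM2r //.
  by have := geom_gt0 n; lra.
have /choice[G hG] : forall x, exists l, (fun n => `|p n x - l|) @ \oo --> (0 : R).
  move=> x; have [//|e e0|l _ hl] := bl_complete hE (w := p^~ x) _ _; last by exists l.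
  have x1 : 0 < `|x| + 1 by rewrite ltr_wpDl.
  have e4 : 0 < e / (4 * (`|x| + 1)) by rewrite divr_gt0 // mulr_gt0.
  have [n0 hn0] := geom_small e4; exists n0 => m n m0 n0'.
  rewrite -[p m x](subrK (p n0 x)) -addrA.
  apply: le_lt_trans (ler_normD _ _) _; rewrite [`|p n0 x - _|]distrC.
  apply: le_lt_trans (lerD (ptail2 _ _ _ m0) (ptail2 _ _ _ n0')) _.
  have := hn0 n0 (leqnn _); rewrite ltr_pdivlMr; last by rewrite mulr_gt0.
  by have := geom_gt0 n0; have := normr_ge0 x; nra.
have pG x : p^~ x @ \oo --> G x.
  apply/cvgrPdist_lt => e e0.
  have [n0 _ hn] := (cvg_norm0P (fun n => p n x - G x) _).1 (hG x) e e0.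
  by exists n0 => // n /hn /=; rewrite distrC.
have lp k : linear (p k).
  move=> a x y; rewrite /p scaler_sumr -big_split /=.
  by apply: eq_bigr => j _; rewrite lD.
exists G; split=> [a x y|k x].
  have h1 : p^~ (a *: x + y) @ \oo --> a *: G x + G y.
    rewrite (_ : p^~ _ = (fun n => a *: p n x + p n y)); last first.
      by apply/funext => n; apply: lp.
    by apply: cvgD => //; apply: cvgZr.
  exact: norm_cvg_unique (pG _) h1.
rewrite pE; apply/ler_addgt0Pr => e e0.
have [n _ hn] := (cvg_norm0P (fun n => p n x - G x) _).1 (hG x) e e0.
have := hn (maxn n k) (leq_maxl _ _); have := ptail2 k _ x (leq_maxr n k).
move: (p (maxn n k) x) => z h1 h2; rewrite -[G x](subrK z) -addrA.
apply: le_trans (ler_normD _ _) _; rewrite [`|G x - z|]distrC [leRHS]addrC.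
by apply: lerD => //; apply: ltW.
Qed.

Lemma dominated_closed T S :
  (forall x (e : R), 0 < e -> exists T' S',
     [/\ dominated le T' S', `|T' x - T x| < e & `|S' x - S x| < e]) ->
  dominated le T S.
Proof.
move=> H x hx; split; apply: (pos_closed hE) => e e0;
  have e2 : 0 < e / 2 by rewrite divr_gt0.
all: have [T' [S' [dT hT domS]]] := H x _ e2; have [h1 h2] := dT x hx.
  exists (S' x - T' x) => //.
  have -> : S' x - T' x - (S x - T x) = (S' x - S x) - (T' x - T x).
    by rewrite !opprB [T x - S x]addrC addrACA [- T' x + _]addrC.
  by apply: le_lt_trans (ler_normB _ _) _; lra.
exists (S' x + T' x) => //; rewrite opprD addrACA.
by apply: le_lt_trans (ler_normD _ _) _; lra.
Qed.

Variable P : set (E -> E).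
Hypothesis hP : operator_ideal le P.
Local Notation J := (r_op le P).
Local Notation N := (r_norm le P).

(** Along a rapidly Cauchy subsequence the increments are dominated by positive
    operators [S k] with summable norms. The remainders of the series of
    increments are dominated by those of [\sum_k S k], which is again in [P];
    this gives both the membership of the limit in [r_op P] and the convergence
    for the regular norm. *)
Lemma r_norm_complete (w : nat -> E -> E) : (forall n, J (w n)) ->
  (forall e : R, 0 < e -> exists n0 : nat, forall m n : nat,
      (n0 <= m)%N -> (n0 <= n)%N -> N (w m - w n) < e) ->
  exists2 l, J l & N (w n - l) @[n --> \oo] --> (0 : R).
Proof.
move=> Jw cw.
have JB U V : J U -> J V -> J (U - V).
  by move=> JU JV; apply: (r_opD hE hP) => //; apply: (r_opN hE hP).
have /choice[n0 hn0] : forall k, exists n0 : nat, forall m n : nat,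
    (n0 <= m)%N -> (n0 <= n)%N -> N (w m - w n) < geom k.
  by move=> k; apply: cw.
(* The running maximum makes the subsequence [s] nondecreasing. *)
pose s k := (\max_(j < k.+1) n0 j)%N.
have s_ge k : (n0 k <= s k)%N.
  exact: (leq_bigmax (F := fun j : 'I_k.+1 => n0 j) ord_max).
have s_le k : (s k <= s k.+1)%N by rewrite {2}/s big_ord_recr leq_maxl.
pose d k := w (s k.+1) - w (s k).
have Jd k : J (d k) by apply: JB.
have /choice[S domS] : forall k, exists S,
    [/\ P S, dominated le (d k) S & op_norm S < geom k].
  move=> k; apply: (r_norm_approx hE hP) => //; apply: hn0 => //.
  exact: leq_trans (s_ge k) (s_le k).
have PS k : P (S k) by case: (domS k).
have dS k : dominated le (d k) (S k) by case: (domS k).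
have oS k : L_op (S k) by apply: (oi_op hP).
have lS k : linear (S k) by apply: L_op_linear.
have ld k : linear (d k) by apply: (r_op_linear hE hP).
have bS k x : `|S k x| <= geom k * `|x|.
  apply: le_trans (op_norm_bound _ (oS k)) _; rewrite ler_wpM2r //.
  by apply: ltW; case: (domS k).
have bd k x : `|d k x| <= geom k * `|x|.
  apply: le_trans (dominated_norm hE _ (ld k) (oS k) (dS k)) _.
  by rewrite ler_wpM2r //; apply: ltW; case: (domS k).
have [G [lG hG]] := op_series lS bS; have [L [lL hL]] := op_series ld bd.
pose p k := \sum_(0 <= j < k) S j; pose q k := \sum_(0 <= j < k) d j.
have Pp k : P (p k).
  rewrite /p; elim: k => [|k IHk]; first by rewrite big_geq //; exact: (oi0 hP).
  by rewrite big_nat_recr //=; apply: (oiD hP).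
have PG : P G.
  apply: (oi_closed hP) => // e e0; have e2 : 0 < e / 2 by rewrite divr_gt0.
  have [n hn] := geom_small e2; exists (p n) => // x.
  apply: le_trans (hG n x) _; rewrite ler_wpM2r //.
  by have := hn n (leqnn n); lra.
have qp k i : dominated le (q (k + i)%N - q k) (p (k + i)%N - p k).
  elim: i => [|i IHi].
    by rewrite addn0 !subrr; apply: (dominated_self hE) => x _; exact: (pos0 hE).
  rewrite addnS /q /p !big_nat_recr //= -/(q _) -/(p _) ![_ + _ - _]addrAC.
  exact: (dominatedD hE).
(* Domination of the finite blocks from [k] to [k + n] passes to the limit. *)
have dom k : dominated le (L - q k) (G - p k).
  apply: dominated_closed => x e e0.
  have x1 : 0 < `|x| + 1 by rewrite ltr_wpDl.
  have e2 : 0 < e / (2 * (`|x| + 1)) by rewrite divr_gt0 // mulr_gt0.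
  have [n hn] := geom_small e2.
  have small : geom (k + n)%N * 2 * `|x| < e.
    have := hn (k + n)%N (leq_addl _ _); rewrite ltr_pdivlMr ?mulr_gt0 //.
    by have := geom_gt0 (k + n)%N; nra.
  have cancel U V (f g : E -> E) : `|f x - U x| <= geom (k + n)%N * 2 * `|x| ->
      `|(U - V) x - (f - V) x| < e.
    by rewrite !fctE opprB addrA subrK distrC => /le_lt_trans; apply.
  exists (q (k + n)%N - q k), (p (k + n)%N - p k); split; first exact: qp.
    by apply: cancel (hL _ _).
  by apply: cancel (hG _ _).
have JL : J L.
  apply/(r_opP hE hP); split=> //; exists G => //.
  by have := dom 0%N; rewrite /q /p !big_geq // !subr0.
pose l := w (s 0%N) + L; exists l; first exact: (r_opD hE hP).
have lE k : w (s k) - l = - (L - q k).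
  by rewrite /q telescope_sumr // /l !opprB opprD addrA addrAC.
have Jl : J l by exact: (r_opD hE hP).
have tail k : N (w (s k) - l) <= geom k * 2.
  have PGp : P (G - p k) by apply: (oiD hP) => //; rewrite -scaleN1r; apply: (oiZ hP).
  rewrite lE; apply: le_trans (r_norm_le hP PGp (dominatedN (dom k))) _.
  by apply: op_norm_le => [|x]; [rewrite mulr_ge0 // ltW|exact: hG].
apply/cvgr0Pnorm_lt => e e0; have e3 : 0 < e / 3 by rewrite divr_gt0.
have [k hk] := geom_small e3; exists (s k) => // n /= sn.
rewrite ger0_norm; last by apply: (r_norm_ge0 hE hP); apply: JB.
rewrite -[w n](subrK (w (s k))) -addrA.
apply: le_lt_trans (r_normD hE hP _ _) _; try by apply: JB.
have := tail k; have := hk k (leqnn k).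
have := hn0 k n (s k) (leq_trans (s_ge k) sn) (s_ge k); lra.
Qed.

End Completeness.

(** * The Banach lattice algebra and the role of the identity *)

Lemma r_op_banach_lattice_algebra (R : realType) (E : normedModType R)
    (le : E -> E -> Prop) (P : set (E -> E)) :
  banach_lattice setT le (fun x : E => `|x|) -> dedekind_complete setT le ->
  operator_ideal le P ->
  banach_lattice_algebra (r_op le P) (op_le le) (r_norm le P)
    (fun S T : E -> E => S \o T).
Proof.
move=> hE dc hP.
have lin T : r_op le P T -> linear T by apply: (r_op_linear hE hP).
split.
- split.
  + exact: r_op_submod.
  + by move=> T _ x _; rewrite subrr; exact: (pos0 hE).
  + move=> S T /lin lS /lin lT ST TS; apply/funext => x.
    have [u [v [hu hv ->]]] := pos_generating hE x.
    have eq_pos y : le 0 y -> S y = T y.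
      move=> hy; apply/esym/eqP; rewrite -subr_eq0; apply/eqP/(pos_anti hE).
        exact: ST.
      by rewrite opprB; apply: TS.
    by rewrite !linear_funB // !eq_pos.
  + move=> S T U _ _ _ ST TU x hx.
    by have := posD hE (TU x hx) (ST x hx); rewrite !fctE addrA subrK.
  + move=> S T U _ _ _ ST x /ST; rewrite !fctE.
    by rewrite opprD addrACA subrr addr0.
  + move=> a S T _ _ a0 ST x /ST; rewrite !fctE -scalerBr.
    exact: (posZ hE).
  + by move=> S T; apply: r_op_sup.
  + by move=> S T; apply: r_op_inf.
  + by move=> T; apply: r_norm_ge0.
  + by move=> T; apply: r_norm0.
  + by move=> a T; apply: r_normZ.
  + by move=> S T; apply: r_normD.
  + by move=> S T u v; apply: r_norm_le_abs.
  + exact: r_norm_complete.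
- by move=> S T /(r_op_sub_L_r hP); apply: r_op_comp.
- by [].
- by [].
- by move=> S T U /lin lS _ _; apply/funext => x /=; rewrite !fctE linear_funD.
- by [].
- by move=> a S T /lin lS _; apply/funext => x /=; rewrite !fctE linear_funZ.
- move=> S T _ _ /op_le0P pS /op_le0P pT; apply/op_le0P => x hx.
  by apply: pS; apply: pT.
- by move=> S T; apply: r_normM.
Qed.

(** If the identity, which is regular, is a difference of positive members of
    [P], then a member of [P] dominates it. Conversely [T = T \o id] is in [P]
    as soon as [id] is. *)
Lemma r_op_eq_L_r (R : realType) (E : normedModType R) (le : E -> E -> Prop)
    (P : set (E -> E)) :
  banach_lattice setT le (fun x : E => `|x|) -> operator_ideal le P ->
  (r_op le P = L_r le) <-> P id.
Proof.
move=> hE hP; have hL := L_op_ideal hE.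
have lid : linear (id : E -> E) by [].
have L_id : L_op (id : E -> E) by split=> // x; exact: cvg_id.
split=> [JL|Pid].
  have /(r_opP hE hP)[_ [S PS dS]] : r_op le P id.
    rewrite JL; apply/(r_opP hE hL); split=> //; exists id => //.
    by apply: (dominated_self hE).
  exact: (oi_dominated hP lid PS dS).
apply/seteqP; split; first exact: r_op_sub_L_r.
move=> T [T1 [T2 [L1 L2 p1 p2 ->]]]; exists T1, T2; split=> //.
  exact: (oi_comp hP L1 Pid).
exact: (oi_comp hP L2 Pid).
Qed.

Theorem theorem1 (R : realType) (E : normedModType R) (le : E -> E -> Prop)
    (hE : banach_lattice setT le (fun x : E => `|x|)) :
  [/\ left_algebraic_ideal le (r_op le (L_Leb le)),
      left_algebraic_ideal le (r_op le (L_sLeb le)),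
      subalgebra le (r_op le (L_Leb le))
    & subalgebra le (r_op le (L_sLeb le))]
  /\
  ((r_op le (L_Leb le) = L_r le <-> order_continuous_norm le) /\
   (r_op le (L_sLeb le) = L_r le <-> sigma_order_continuous_norm le))
  /\
  (dedekind_complete setT le ->
    [/\ forall T : E -> E, r_op le (L_Leb le) T ->
          r_norm le (L_Leb le) T = r_norm le (L_r le) T,
        banach_lattice_algebra (r_op le (L_Leb le)) (op_le le)
          (r_norm le (L_Leb le)) (fun S T : E -> E => S \o T)
      & banach_lattice_algebra (r_op le (L_sLeb le)) (op_le le)
          (r_norm le (L_sLeb le)) (fun S T : E -> E => S \o T)]).
Proof.
have hL := L_Leb_ideal hE; have hs := L_sLeb_ideal hE.
have iL := r_op_left_ideal hE hL; have ils := r_op_left_ideal hE hs.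
split; first by split=> //; exact: left_ideal_subalgebra.
split.
  have L_id : L_op (id : E -> E) by split=> // x; exact: cvg_id.
  split.
    apply: (iff_trans (r_op_eq_L_r hE hL)).
    by split=> [[_ H]|H]; [exact: H|split].
  apply: (iff_trans (r_op_eq_L_r hE hs)).
  by split=> [[_ H]|H]; [exact: H|split].
move=> dc; split; try exact: r_op_banach_lattice_algebra.
by move=> T hT; rewrite (r_norm_L_op hE dc hL hT) (r_norm_L_r hE).
Qed.
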